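(* Let $1\le k\le d-1$ be integers. If $d-k$ is even, then $$n(k,d)\le \max\left\{\sum_{j=0}^{k}\binom{d}{j},\ \sum_{j=1}^{\frac{d-k-2}{2}}\left(\frac{1}{2^{j+1}}-\frac{1}{2^{d-k-j}}\right)\left|B_{k+2j}^{(d)}\right|+2^{\frac{d+k}{2}}\right\}.$$ If $d-k$ is odd, then $$n(k,d)\le \max\left\{\sum_{j=0}^{k}\binom{d}{j},\ \sum_{j=1}^{\frac{d-k-3}{2}}\left(\frac{1}{2^{j+1}}-\frac{1}{2^{d-k-j}}\right)\left|B_{k+2j}^{(d)}\right|+\frac{1}{2^{\frac{d-k+1}{2}}}\left|B_{d-1}^{(d)}\right|+2^{\frac{d+k-1}{2}}\right\}.$$
   Context: A standard box in $\mathbb{R}^d$ is a set $K=K_1\times\cdots\times K_d$ where each $K_i\subseteq\mathbb{R}$ is a closed interval. A finite family of $d$-dimensional standard boxes in $\mathbb{R}^d$ is called $k$-neighborly if the dimension of the intersection of any two distinct members is in $\{d-k,d-k+1,\ldots,d-1\}$ (in particular the intersection is nonempty). For positive integers $1\le k\le d$, $n(k,d)$ is the maximum number of members of a $k$-neighborly family of $d$-dimensional standard boxes in $\mathbb{R}^d$. For a nonnegative integer $m\le d-1$, the configuration $B_m^{(d)}\subseteq\{0,1\}^d$ is defined as follows: if $m=2t$, it is the set of binary vectors of length $d$ with at most $t$ coordinates equal to $1$; if $m=2t+1$, it is the Cartesian product of $\{0,1\}$ with the set of binary vectors of length $d-1$ with at most $t$ coordinates equal to $1$. Thus $|B_m^{(d)}|=\sum_{i=0}^{t}\binom{d}{i}$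 if $m=2t$, and $|B_m^{(d)}|=2\sum_{i=0}^{t}\binom{d-1}{i}$ if $m=2t+1$. Empty sums (upper limit smaller than the lower limit) equal $0$. *)

(* Defs.v *)
From HB Require Import structures.
From mathcomp Require Import all_boot all_order all_algebra.
From mathcomp Require Import all_classical reals.

Set Implicit Arguments.
Unset Strict Implicit.
Unset Printing Implicit Defensive.

Import Order.TTheory GRing.Theory Num.Theory.

Local Open Scope classical_set_scope.
Local Open Scope ring_scope.

Section Boxes.
Variables (R : realType) (d : nat).
Implicit Types (A K L : set 'rV[R]_d) (F : set (set 'rV[R]_d)).

(* The dimension of [A] is that of its affine hull, whose direction is the
   least subspace [V] containing all differences of points of [A]; the empty
   set has no dimension. *)
Definition contains_differences A (V : {vspace 'rV[R]_d}) : Prop :=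
  forall x y, A x -> A y -> x - y \in V.

Definition has_dim A (m : nat) : Prop :=
  A !=set0 /\
  exists V : {vspace 'rV[R]_d},
    [/\ contains_differences A V,
        forall W, contains_differences A W -> (V <= W)%VS
      & \dim V = m].

Definition box (a b : 'rV[R]_d) : set 'rV[R]_d :=
  [set x | forall i, a 0 i <= x 0 i <= b 0 i].

Definition standard_box K : Prop :=
  exists a b : 'rV[R]_d, (forall i, a 0 i <= b 0 i) /\ K = box a b.

Definition neighborly_family (k : nat) F : Prop :=
  [/\ finite_set F,
      forall K, F K -> standard_box K /\ has_dim K d
    & forall K L, F K -> F L -> K <> L ->
        exists m, (d - k <= m < d)%N /\ has_dim (K `&` L) m].

Definition neighborly_size (k : nat) : pred nat :=
  fun n => `[< exists F, neighborly_family k F /\ (F #= `I_n)%card >].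

Lemma box_full_lt (a b : 'rV[R]_d) :
  has_dim (box a b) d -> forall i, a 0 i < b 0 i.
Proof.
move=> [[x0 hx0] [V [_ hmin hdim]]] i; rewrite ltNge; apply/negP => hba.
have coordL : linear (fun x : 'rV[R]_d => x 0 i : R^o).
  by move=> c u v; rewrite !mxE.
pose cL := GRing.isLinear.Build _ _ _ _ _ coordL.
pose f : {linear 'rV[R]_d -> R^o} := HB.pack (fun x : 'rV[R]_d => x 0 i : R^o) cL.
have coordE (x : 'rV[R]_d) : linfun f x = x 0 i by rewrite lfunE.
have /hmin sVK : contains_differences (box a b) (lker (linfun f)).
  move=> x y /(_ i)/andP[ax xb] /(_ i)/andP[ay yb].
  rewrite memv_ker coordE !mxE subr_eq0; apply/eqP/le_anti.
  by rewrite (le_trans xb (le_trans hba ay)) (le_trans yb (le_trans hba ax)).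
have VT : V = fullv.
  by apply/eqP; rewrite eqEdim subvf hdim dimvf dim_matrix mul1r /= leqnn.
have : delta_mx 0 i \in lker (linfun f) by apply: (subvP sVK); rewrite VT memvf.
by rewrite memv_ker coordE !mxE !eqxx oner_eq0.
Qed.

Lemma box_lt_full (a b : 'rV[R]_d) m :
  (forall i, a 0 i < b 0 i) -> has_dim (box a b) m -> m = d.
Proof.
move=> ab [_ [V [hV _ <-]]].
have delV i : delta_mx 0 i \in V.
  have di0 : b 0 i - a 0 i != 0 by rewrite subr_eq0 gt_eqF.
  rewrite -[delta_mx 0 i]scale1r -(mulVf di0) -scalerA memvZ//.
  rewrite -[_ *: _](addrK a); apply: hV => j; last by rewrite lexx ltW.
  rewrite !mxE eqxx /=; case: eqVneq => [->|_].
    by rewrite mulr1 subrK lexx ltW.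
  by rewrite mulr0 add0r lexx ltW.
have -> : V = fullv.
  apply/vspaceP => x; rewrite memvf [x]row_sum_delta.
  by apply: memv_suml => i _; rewrite memvZ.
by rewrite dimvf dim_matrix mul1r.
Qed.

Lemma boxI (a b a' b' : 'rV[R]_d) :
  box a b `&` box a' b' =
  box (\row_i Num.max (a 0 i) (a' 0 i)) (\row_i Num.min (b 0 i) (b' 0 i)).
Proof.
apply/seteqP; split => x /=.
  move=> [h h'] i; rewrite !mxE ge_max le_min.
  by case/andP: (h i) => -> ->; case/andP: (h' i) => -> ->.
by move=> h; split => i; have := h i; rewrite !mxE ge_max le_min;
   move=> /andP[/andP[? ?] /andP[? ?]]; apply/andP; split.
Qed.

(* The coordinates in which some member of [F] lies entirely above [K]. *)
Definition above F K : {set 'I_d} :=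
  [set i | `[< exists2 L, F L & forall x y, K x -> L y -> x 0 i <= y 0 i >]].

Lemma above_neq k F (a b a' b' : 'rV[R]_d) i : neighborly_family k F ->
  F (box a b) -> F (box a' b') -> b 0 i <= a' 0 i ->
  above F (box a b) != above F (box a' b').
Proof.
move=> [_ hF hI] FK FL ba'; apply/eqP => /setP/(_ i); rewrite !inE.
have -> : `[< exists2 L, F L &
    forall x y, box a b x -> L y -> x 0 i <= y 0 i >].
  apply/asboolP; exists (box a' b') => // x y /(_ i)/andP[_ xb] /(_ i)/andP[ay _].
  exact: le_trans xb (le_trans ba' ay).
move=> /esym/asboolP[M FM hM].
have lt' := box_full_lt (hF _ FL).2.
have [z [Kz Mz]] : box a b `&` M !=set0.
  have [<-|KM] := pselect (box a b = M).
    by rewrite setIid; have [_ []] := hF _ FK.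
  by have [m [_ []]] := hI _ _ FK FM KM.
have b'L : box a' b' b' by move=> j; rewrite lexx ltW.
have /andP[_ zb] := Kz i.
by have := lt' i; rewrite ltNge (le_trans (hM _ _ b'L Mz))// (le_trans zb).
Qed.

Lemma above_inj k F : neighborly_family k F ->
  {in F &, injective (above F)}.
Proof.
move=> nF K L; rewrite !inE => FK FL eqKL; apply: contrapT => KL.
have [_ hF hI] := nF.
have [[a [b [_ KE]]] dK] := hF _ FK; have [[a' [b' [_ LE]]] dL] := hF _ FL.
have [m [/andP[_ md] ]] := hI _ _ FK FL KL.
move: FK FL dK dL eqKL; rewrite {}KE {}LE => FK FL dK dL eqKL dI.
have [i] : exists i, (b 0 i <= a' 0 i) || (b' 0 i <= a 0 i).
  apply: contrapT => /forallNP h; move: dI; rewrite boxI => /box_lt_full dI.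
  move: md; rewrite dI ?ltnn// => i; rewrite !mxE gt_max !lt_min.
  rewrite !(box_full_lt dK) !(box_full_lt dL) andbT /=.
  by have /negP := h i; rewrite negb_or -!ltNge => /andP[-> ->].
case/orP => ba.
  by have := above_neq nF FK FL ba; rewrite eqKL eqxx.
by have := above_neq nF FL FK ba; rewrite eqKL eqxx.
Qed.

Lemma neighborly_size_ex k : exists n, neighborly_size k n.
Proof.
exists 0%N; apply/asboolP; exists set0; split; last by rewrite II0.
by split=> //; apply: finite_set0.
Qed.

Lemma neighborly_size_ub k n : neighborly_size k n -> (n <= 2 ^ d)%N.
Proof.
move=> /asboolP[F [nF Fn]].
rewrite -card_le_II -(card_le_eql Fn).
pose g K : nat := enum_rank (above F K).
have gI : {in F &, injective g}.
  by move=> K L FK FL /val_inj/enum_rank_inj/(above_inj nF); apply.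
rewrite -(card_le_eql (inj_card_eq gI)); apply: subset_card_le => _ [K _ <-] /=.
by rewrite (leq_trans (ltn_ord _))// -cardsT -powersetT card_powerset cardsT card_ord.
Qed.

End Boxes.

Definition neighborly_number (R : realType) (k d : nat) : nat :=
  ex_maxn (neighborly_size_ex R d k) (@neighborly_size_ub R d k).

(* For odd m = 2t + 1, the first coordinate is unconstrained. *)
Definition Bconf (m d : nat) : {set d.-tuple bool} :=
  [set v : d.-tuple bool |
     (count id (if odd m then behead (tval v) else tval v) <= m %/ 2)%N].

(* Main.v *)
(* In each coordinate two members of a neighborly family either overlap or touch,
   and by pairwise intersection all touchings of a coordinate happen at one point,
   with some boxes ending and others starting there. This encodes a box as a word
   over {0, 1, *}, two words having between 1 and k coordinates of conflict 0/1,
   i.e. as a subcube of {0,1}^d, these subcubes being disjoint.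
   If some word has no star, a word is determined by its conflicts with it, which
   gives the first bound. Otherwise let S_j be the number of points of the
   subcubes with at most j stars, so S_0 = 0. These points have diameter at most
   k + 2j, so S_j <= |B_(k+2j)| by Kleitman's theorem; and since points of the
   levels j and d-k-1-j are never antipodal, S_j + S_(d-k-1-j) <= 2^d. The number
   of members is at most sum_(j < d-k) S_j / 2^(j+1) + 2^d / 2^(d-k) by summation
   by parts, and pairing j with d-k-1-j gives the second bound. *)
Require Import Defs.
From mathcomp Require Import all_boot all_order all_algebra.
From mathcomp Require Import perm.
From mathcomp Require Import all_classical reals.
From mathcomp Require Import zify lra.

Set Implicit Arguments.
Unset Strict Implicit.
Unset Printing Implicit Defensive.

Import Order.TTheory GRing.Theory Num.Theory.

(** * Compression by weight-decreasing isometries *)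

(** The elementary shift: a point moves only if this lowers its weight and its target is still free,
    so no two points collide. *)
Definition compression (T : finType) (w : T -> nat) (f : T -> T) (F : {set T})
    (x : T) :=
  if (w (f x) < w x) && (f x \notin F) then f x else x.

Lemma compression_inj (T : finType) (w : T -> nat) (f : T -> T) (F : {set T}) :
  involutive f -> {in F &, injective (compression w f F)}.
Proof.
move=> fK x y Fx Fy; rewrite /compression.
case: andP => [[_ Nfx]|_]; case: andP => [[_ Nfy]|_] //.
- exact: (can_inj fK).
- by move=> E; rewrite E Fy in Nfx.
- by move=> E; rewrite -E Fx in Nfy.
Qed.

(** Among the families of the same size and diameter bound, one of least total weight works: if a
    point could still move to a free place, compressing the whole family would lower the total
    weight. *)
Lemma exists_compressed (T : finType) (dist : T -> T -> nat) (w : T -> nat)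
    (I : Type) (f : I -> T -> T) (m : nat) (F : {set T}) :
  (forall x y, dist x y = dist y x) ->
  (forall i, involutive (f i)) ->
  (forall i x y, dist (f i x) (f i y) = dist x y) ->
  (forall i x y, w (f i x) < w x -> w y <= w (f i y) ->
     dist (f i x) y <= dist x y) ->
  {in F &, forall x y, dist x y <= m} ->
  exists G : {set T}, [/\ #|G| = #|F|, {in G &, forall x y, dist x y <= m}
    & forall i x, x \in G -> w (f i x) < w x -> f i x \in G].
Proof.
move=> distC fK fI fD diamF.
pose P (G : {set T}) :=
  (#|G| == #|F|) && [forall x in G, forall y in G, dist x y <= m].
have PF : P F.
  rewrite /P eqxx; apply/forall_inP => x Fx; apply/forall_inP => y Fy.
  exact: diamF.
have [G /andP[/eqP cG /forall_inP dG] minG] :=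
  arg_minnP (fun G : {set T} => \sum_(x in G) w x) PF.
have {}dG : {in G &, forall x y, dist x y <= m}.
  by move=> x y /dG/forall_inP; apply.
exists G; split=> // i x Gx wx; apply: contraT => Nfx.
pose h := compression w (f i) G.
have hI : {in G &, injective h} by apply: compression_inj.
have hm y : w (h y) <= w y by rewrite /h /compression; case: ifP => // /andP[/ltnW].
have : P (h @: G).
  rewrite /P card_in_imset // cG eqxx; apply/forall_inP => _ /imsetP[y Gy ->].
  apply/forall_inP => _ /imsetP[z Gz ->]; rewrite /h /compression.
  (* The mixed pair, [a] moved and [b] fixed. Either [f i] does not lower the weight of [b], and the
     hypothesis on such pairs applies, or [f i b] is already in [G], and the isometry carries the
     pair to [a] and [f i b]. *)
  have moved a b : a \in G -> b \in G -> w (f i a) < w a ->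
      ~~ ((w (f i b) < w b) && (f i b \notin G)) -> dist (f i a) b <= m.
    move=> Ga Gb wa; rewrite negb_and -leqNgt negbK => /orP[wb|Gfb].
      exact: leq_trans (fD _ _ _ wa wb) (dG _ _ Ga Gb).
    by rewrite -(fK i b) fI dG.
  case: ifP => [/andP[wy _]|/negbT Ny]; case: ifP => [/andP[wz _]|/negbT Nz].
  - by rewrite fI dG.
  - exact: moved.
  - by rewrite distC moved.
  - exact: dG.
move=> /minG; rewrite big_imset //= leqNgt => /negP[].
rewrite (bigD1 x) //= [X in _ < X](bigD1 x) //= -addSn leq_add ?leq_sum //.
by rewrite /h /compression wx Nfx.
Qed.

(** * Antipodes, flips and swaps in the discrete cube *)

Section Cube.
Variable n : nat.
Implicit Types x y : {ffun 'I_n -> bool}.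

Definition hamming x y : nat := \sum_i (x i (+) y i).

Lemma hammingC x y : hamming x y = hamming y x.
Proof. by apply: eq_bigr => i _; rewrite addbC. Qed.

Definition antipode x : {ffun 'I_n -> bool} := [ffun i => ~~ x i].

Lemma antipodeK : involutive antipode.
Proof. by move=> x; apply/ffunP => i; rewrite !ffunE negbK. Qed.

Lemma hamming_antipode x : hamming (antipode x) x = n.
Proof.
rewrite /hamming -[RHS]card_ord -sum1_card; apply: eq_bigr => i _.
by rewrite ffunE; case: (x i).
Qed.

(** A point at distance less than [n] from [y] is not its antipode, so the antipodes of [F] are
    disjoint from [G]. *)
Lemma card_antipodes (F G : {set {ffun 'I_n -> bool}}) :
  {in F & G, forall x y, hamming x y < n} -> #|F| + #|G| <= 2 ^ n.
Proof.
move=> FG; rewrite -(card_imset (mem F) (can_inj antipodeK)).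
have [_] := leq_card_setU (antipode @: F) G.
have -> : [disjoint antipode @: F & G].
  apply/pred0P => x /=; apply/andP => -[/imsetP[y Fy ->] Gy].
  by have := FG _ _ Fy Gy; rewrite hammingC hamming_antipode ltnn.
move=> /eqP <-; rewrite (leq_trans (max_card _)) // card_ffun card_bool card_ord //.
Qed.

Definition flip (i : 'I_n) x : {ffun 'I_n -> bool} := [ffun j => x j (+) (j == i)].

Lemma flipK i : involutive (flip i).
Proof. by move=> x; apply/ffunP => j; rewrite !ffunE addbK. Qed.

Lemma hamming_flip i x y : hamming (flip i x) (flip i y) = hamming x y.
Proof. by apply: eq_bigr => j _; rewrite !ffunE addbACA addbb addbF. Qed.


Lemma hamming_flip_lt i x y : x i -> ~~ y i -> hamming (flip i x) y <= hamming x y.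
Proof.
move=> xi yi; apply: leq_sum => j _; rewrite !ffunE.
by have [->|] := eqVneq j i; rewrite ?addbF // xi (negbTE yi).
Qed.

Definition swap (i0 i : 'I_n) x : {ffun 'I_n -> bool} := [ffun j => x (tperm i0 i j)].

Lemma swapK i0 i : involutive (swap i0 i).
Proof. by move=> x; apply/ffunP => j; rewrite !ffunE tpermK. Qed.

Lemma hamming_swap i0 i x y : hamming (swap i0 i x) (swap i0 i y) = hamming x y.
Proof.
rewrite /hamming [RHS](reindex_inj (@perm_inj _ (tperm i0 i))) /=.
by apply: eq_bigr => j _; rewrite !ffunE.
Qed.

(** Only [i0] and [i] matter. There [x] reads 1,0 and becomes 0,1, while [y] reads 0,0 or 0,1 or
    1,1, and none of these gets farther away. *)
Lemma hamming_swap_lt i0 i x y : x i0 -> ~~ x i -> y i0 <= y i ->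
  hamming (swap i0 i x) y <= hamming x y.
Proof.
move=> x0 xi yi; have i0i : i != i0 by apply: contraNneq xi => ->.
rewrite /hamming (bigD1 i0) //= (bigD1 i) //= [X in _ <= X](bigD1 i0) //=.
rewrite [X in _ <= _ + X](bigD1 i) //= !addnA leq_add //.
  rewrite !ffunE tpermL tpermR x0 (negbTE xi).
  by move: yi; case: (y i0); case: (y i).
apply: leq_sum => j /andP[j0 ji].
by rewrite ffunE tpermD // eq_sym.
Qed.

(** Ones count once, except at [i0] where they count twice. A single weight thus drops both when a 1
    is erased and when a 1 is moved out of [i0]. *)
Definition head_weight i0 x : nat := \sum_i x i + x i0.

Lemma head_weight_flip i0 i x : (head_weight i0 (flip i x) < head_weight i0 x) = x i.
Proof.
rewrite /head_weight (bigD1 i) //= [X in _ < X + _](bigD1 i) //= !ffunE eqxx addbT.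
rewrite (eq_bigr (fun j => x j : nat)); last first.
  by move=> j /negbTE ji; rewrite ffunE ji addbF.
by have [->|_] := eqVneq i0 i; case: (x i); rewrite ?addbF ?addbT /=; lia.
Qed.

Lemma head_weight_swap i0 i x :
  (head_weight i0 (swap i0 i x) < head_weight i0 x) = (x i < x i0).
Proof.
rewrite /head_weight [X in _ < X + _](reindex_inj (@perm_inj _ (tperm i0 i))) /=.
rewrite (eq_bigr (fun j => x (tperm i0 i j) : nat)); last by move=> j; rewrite ffunE.
by rewrite ffunE tpermL ltn_add2l.
Qed.

Lemma exists_shifted i0 (m : nat) (F : {set {ffun 'I_n -> bool}}) :
  {in F &, forall x y, hamming x y <= m} ->
  exists G : {set {ffun 'I_n -> bool}},
    [/\ #|G| = #|F|, {in G &, forall x y, hamming x y <= m},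
       forall i x, x \in G -> x i -> flip i x \in G
     & forall i x, x \in G -> x i0 -> ~~ x i -> swap i0 i x \in G].
Proof.
(* The sum type lets flips and swaps be compressed together, so that one minimal family is stable
   under both. *)
pose f (s : 'I_n + 'I_n) := match s with inl i => flip i | inr i => swap i0 i end.
move=> dF; have [|||i x y|G [cG dG fG]] :=
    @exists_compressed _ hamming (head_weight i0) _ f m F _ _ _ _ dF.
- exact: hammingC.
- by case=> i; [apply: flipK | apply: swapK].
- by case=> i x y; [apply: hamming_flip | apply: hamming_swap].
- rewrite /f; case: i => i /=; last first.
    rewrite (leqNgt (head_weight i0 y)) !head_weight_swap -leqNgt.
    by case: (x i) (x i0) (@hamming_swap_lt i0 i x y) => -[]//= + _; apply.
  rewrite (leqNgt (head_weight i0 y)) !head_weight_flip; exact: hamming_flip_lt.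
exists G; split=> // i x Gx.
  by move=> xi; apply: (fG (inl i)) => //; rewrite /f head_weight_flip.
move=> x0 xi; apply: (fG (inr i)) => //.
by rewrite /f head_weight_swap x0 (negbTE xi).
Qed.

End Cube.

(** * Sizes of Hamming balls and their recursions *)

Definition ball_size (n t : nat) := \sum_(i < t.+1) 'C(n, i).

Lemma ball_sizeS n t : ball_size n.+1 t.+1 = ball_size n t.+1 + ball_size n t.
Proof.
rewrite /ball_size big_ord_recl [in X in _ = X + _]big_ord_recl !bin0 -addnA.
by rewrite -big_split.
Qed.

Lemma ball_size0 n : ball_size n 0 = 1.
Proof. by rewrite /ball_size big_ord_recl big_ord0 bin0. Qed.

(** By the symmetry of the binomial coefficients, the first [t.+1] entries are half of the row of
    index [t.*2.+1]. *)
Lemma ball_size_half t : ball_size t.*2.+1 t = 2 ^ t.*2.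
Proof.
apply/eqP; rewrite -(eqn_pmul2l (isT : 0 < 2)) -expnS mul2n -addnn.
have <- : \sum_(0 <= i < t.*2.+2) 'C(t.*2.+1, i) = 2 ^ t.*2.+1.
  rewrite big_mkord (expnDn 1 1); apply: eq_bigr => i _.
  by rewrite !exp1n !muln1.
apply/eqP; rewrite (big_cat_nat (n := t.+1)) //=; last by lia.
rewrite !big_mkord; congr (_ + _).
rewrite -{1}[t.+1]add0n big_addn big_mkord.
have -> : t.*2.+2 - t.+1 = t.+1 by lia.
rewrite (reindex_inj rev_ord_inj) /=; apply: eq_bigr => i _.
by rewrite -bin_sub; [congr 'C(_, _)|]; have := ltn_ord i; lia.
Qed.

(* Junk value for odd [m] and [n = 0]. *)
Definition kleitman_size (m n : nat) : nat :=
  if odd m then 2 * ball_size n.-1 m./2 else ball_size n m./2.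

Lemma kleitman_size_diag n : kleitman_size n n.+1 = 2 ^ n.
Proof.
rewrite /kleitman_size; have := odd_double_half n.
case: (odd n) => /=; rewrite ?add1n ?add0n => E; rewrite -{1}E ball_size_half.
  by rewrite -expnS E.
by rewrite E.
Qed.

(** The radius is 0, so the size ignores the dimension. This replaces the recursion when [m] cannot
    be lowered by 2. *)
Lemma kleitman_size_small m n : m <= 1 -> kleitman_size m n.+2 = kleitman_size m n.+1.
Proof. by case: m => [|[]] // _; rewrite /kleitman_size /= !ball_size0. Qed.

Lemma kleitman_sizeS m n :
  kleitman_size m.+2 n.+2 = kleitman_size m.+2 n.+1 + kleitman_size m n.+1.
Proof.
by rewrite /kleitman_size /= negbK; case: (odd m); rewrite ball_sizeS // mulnDr.
Qed.

(** * Slices by the first coordinate and Kleitman's theorem *)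

Definition fcons n (b : bool) (x : {ffun 'I_n -> bool}) : {ffun 'I_n.+1 -> bool} :=
  [ffun i => if unlift ord0 i is Some j then x j else b].

Lemma fcons0 n b (x : {ffun 'I_n -> bool}) : fcons b x ord0 = b.
Proof. by rewrite ffunE unlift_none. Qed.

Lemma fconsS n b (x : {ffun 'I_n -> bool}) i : fcons b x (lift ord0 i) = x i.
Proof. by rewrite ffunE liftK. Qed.

Lemma hamming_fcons n b c (x y : {ffun 'I_n -> bool}) :
  hamming (fcons b x) (fcons c y) = (b (+) c) + hamming x y.
Proof.
rewrite /hamming big_ord_recl !fcons0; congr (_ + _).
by apply: eq_bigr => i _; rewrite !fconsS.
Qed.

Lemma card_fcons n (F : {set {ffun 'I_n.+1 -> bool}}) :
  #|F| = #|[set x | fcons false x \in F]| + #|[set x | fcons true x \in F]|.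
Proof.
rewrite -!sum1_card (bigID (fun x : {ffun _ -> bool} => x ord0)) /= addnC.
have split_head b : \sum_(x in F | x ord0 == b) 1 = \sum_(x in [set x | fcons b x \in F]) 1.
  rewrite (reindex (@fcons n b)) /=.
    by apply: eq_bigl => x; rewrite inE fcons0 eqxx andbT.
  exists (fun x => [ffun i => x (lift ord0 i)]) => x.
    by move=> _; apply/ffunP => i; rewrite ffunE fconsS.
  rewrite inE => /andP[_ /eqP <-]; apply/ffunP => i.
  by case: (unliftP ord0 i) => [j|] ->; rewrite ?fconsS ?fcons0 ?ffunE.
by rewrite -!split_head; congr (_ + _); apply: eq_bigl => x; case: (x ord0); rewrite ?andbT ?andbF.
Qed.

(** Single flips from 1 to 0 lead from [x] to any [y] below it, by induction on their distance. *)
Lemma flip_set_mem n (F : {set {ffun 'I_n -> bool}}) :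
  (forall i x, x \in F -> x i -> flip i x \in F) ->
  forall x y : {ffun 'I_n -> bool}, x \in F -> (forall i, y i -> x i) -> y \in F.
Proof.
move=> flipF x y Fx; move: {2}(hamming x y) (erefl (hamming x y)) => h.
elim: h => [|h IH] in x Fx *.
  move=> /eqP; rewrite sum_nat_eq0 => /forallP E _.
  suff -> : y = x by [].
  by apply/ffunP => i; have := E i; case: (x i); case: (y i).
move=> E yx.
have [i xi yi] : exists2 i, x i & ~~ y i.
  case: (pickP (fun i => x i && ~~ y i)) => [i /andP[]|N]; first by exists i.
  move: E; rewrite /hamming big1 // => i _.
  by have := N i; have := yx i; case: (x i); case: (y i) => // /(_ isT).
apply: (IH (flip i x)); first exact: flipF.
  apply/eqP; rewrite -eqSS -E /hamming (bigD1 i) //= [X in _ == X](bigD1 i) //=.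
  rewrite ffunE eqxx addbT xi (negbTE yi) /= add0n add1n eqSS.
  by apply/eqP/eq_bigr => j /negbTE ji; rewrite ffunE ji addbF.
move=> j yj; rewrite ffunE (yx _ yj) /=.
by apply: contraNneq yi => <-.
Qed.

(** Beside [x] two further points are built from [y]: the first is at least as far from [x] as [y]
    is, and the second gains one more unit. Together with the difference in the first coordinate
    this yields the 2. *)
Lemma shifted_slice n m (F : {set {ffun 'I_n.+1 -> bool}}) x y :
  m <= n ->
  {in F &, forall x y, hamming x y <= m} ->
  (forall i x, x \in F -> x i -> flip i x \in F) ->
  (forall i x, x \in F -> x ord0 -> ~~ x i -> swap ord0 i x \in F) ->
  fcons true x \in F -> fcons true y \in F -> hamming x y + 2 <= m.
Proof.
move=> mn dF flipF swapF Fx Fy.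
(* As sets, [z] is [y] minus [x], so its distance to [x] is the size of their union; it lies below
   [y], hence is available with either head. *)
pose z := [ffun i => y i && ~~ x i].
have Fz (b : bool) : fcons b z \in F.
  apply: (flip_set_mem flipF Fy) => i.
  case: (unliftP ord0 i) => [j|] ->; rewrite ?fcons0 // !fconsS ffunE.
  by case/andP.
have xyz : hamming x y <= hamming x z.
  by apply: leq_sum => i _; rewrite ffunE; case: (x i); case: (y i).
have := dF _ _ Fx (Fz false); rewrite hamming_fcons /= add1n => xzm.
(* If [x] and [y] covered all coordinates, [z] would be the antipode of [x], giving distance [n.+1]
   in [F], against [m <= n]. *)
have [i xi yi] : exists2 i, ~~ x i & ~~ y i.
  case: (pickP (fun i => ~~ x i && ~~ y i)) => [i /andP[]|N]; first by exists i.
  suff : hamming x z = n by lia.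
  rewrite /hamming -[RHS]card_ord -sum1_card; apply: eq_bigr => i _; rewrite ffunE.
  by have := N i; case: (x i); case: (y i).
(* Swapping moves the head 1 of [z] to the uncovered coordinate [i], where it differs from [x]. *)
pose z' := [ffun j => z j || (j == i)].
have Fz' : fcons false z' \in F.
  have -> : fcons false z' = swap ord0 (lift ord0 i) (fcons true z).
    apply/ffunP => j; rewrite [RHS]ffunE.
    case: (unliftP ord0 j) => [l|] ->; last by rewrite tpermL fcons0 fconsS ffunE (negbTE yi).
    rewrite fconsS ffunE; have [->|li] := eqVneq l i.
      by rewrite tpermR fcons0 orbT.
    by rewrite tpermD ?fconsS ?orbF // ?neq_lift // (inj_eq lift_inj) eq_sym.
  by apply: swapF; rewrite ?Fz ?fcons0 // fconsS ffunE (negbTE yi).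
have := dF _ _ Fx Fz'; rewrite hamming_fcons /= add1n.
suff -> : hamming x z' = (hamming x z).+1 by lia.
rewrite /hamming (bigD1 i) //= [in RHS](bigD1 i) //= !ffunE eqxx orbT (negbTE xi) (negbTE yi) /=.
rewrite add0n add1n; congr _.+1.
by apply: eq_bigr => j /negbTE ji; rewrite [z' j]ffunE ji orbF.
Qed.

(* The induction follows [kleitman_sizeS]: once the family is shifted, the slice
   where the first coordinate is 1 has diameter at most [m - 2]. *)
Lemma kleitman n m (F : {set {ffun 'I_n -> bool}}) :
  m < n -> {in F &, forall x y, hamming x y <= m} -> #|F| <= kleitman_size m n.
Proof.
elim: n m F => // n IH m F; rewrite ltnS leq_eqVlt => /predU1P[->|mn] dF.
  (* Base case: in dimension [n.+1] a diameter at most [n] excludes antipodal pairs, so [F] fills at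
     most half of the cube. *)
  rewrite kleitman_size_diag -(leq_pmul2l (isT : 0 < 2)) -expnS mul2n -addnn.
  by apply: card_antipodes => x y Fx Fy; rewrite ltnS dF.
have [G [<- {}dF flipF swapF]] := exists_shifted ord0 dF.
have slice := shifted_slice (ltnW mn) dF flipF swapF.
rewrite card_fcons; case: n => [|n] in IH F mn G dF flipF swapF slice *; first by lia.
have IH0 : #|[set x | fcons false x \in G]| <= kleitman_size m n.+1.
  apply: IH => // x y; rewrite !inE => Gx Gy.
  by have := dF _ _ Gx Gy; rewrite hamming_fcons.
case: m => [|[|m]] in mn dF slice IH0 *; last first.
  rewrite kleitman_sizeS leq_add //; apply: IH; first by lia.
  by move=> x y; rewrite !inE => Gx Gy; have := slice _ _ Gx Gy; lia.
(* For [m] at most 1 the slice with head 1 is empty, since even a single point in it would force [m]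
   to be at least 2. *)
all: rewrite kleitman_size_small // [X in _ + X](_ : _ = 0) ?addn0 //.
all: apply/eqP; rewrite cards_eq0; apply/eqP/setP => x; rewrite !inE.
all: by apply/negP => Gx; have := slice _ _ Gx Gx; lia.
Qed.

(** * The configurations attain the sizes in Kleitman's bound *)

Lemma card_small_sets n t : #|[set A : {set 'I_n} | #|A| <= t]| = ball_size n t.
Proof.
rewrite -sum1_card (partition_big (fun A : {set _} => inord #|A| : 'I_t.+1) predT) //=.
apply: eq_bigr => i _; rewrite -[n in RHS]card_ord -card_draws -sum1_card.
apply: eq_bigl => A; rewrite !inE.
have [At|At] := leqP #|A| t; first by rewrite -val_eqE /= inordK.
by apply/esym/eqP => Ai; have := ltn_ord i; rewrite -Ai ltnS leqNgt At.
Qed.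

Lemma card_light_tuples n t :
  #|[set v : n.-tuple bool | count id v <= t]| = ball_size n t.
Proof.
rewrite -card_small_sets.
pose g (A : {set 'I_n}) : n.-tuple bool := [tuple i \in A | i < n].
have gE A : count id (g A) = #|A|.
  by rewrite /g /= count_map cardE enumT /enum_mem size_filter.
have gI : injective g.
  move=> A B /(congr1 (fun v => tnth v)) E; apply/setP => i.
  by have := congr1 (fun f => f i) E; rewrite /g !tnth_mktuple.
rewrite -(card_imset _ gI); apply: eq_card => v; rewrite !inE.
have vE : v = g [set i | tnth v i] by apply: eq_from_tnth => i; rewrite tnth_mktuple inE.
apply/idP/imsetP => [vt|[A + ->]]; last by rewrite inE gE.
by exists [set i | tnth v i]; rewrite // inE -gE -vE.
Qed.

Lemma card_Bconf m d : 0 < d -> #|Bconf m d| = kleitman_size m d.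
Proof.
rewrite /kleitman_size /Bconf divn2; case: (odd m); last by rewrite card_light_tuples.
case: d => // d _; rewrite -card_light_tuples -card_bool -cardsT -cardsX.
pose g (p : bool * d.-tuple bool) := cons_tuple p.1 p.2.
have gI : injective g.
  by move=> [b v] [c w] /(congr1 val) /= [-> /val_inj ->].
rewrite -(card_imset _ gI); apply: eq_card => v; rewrite inE.
apply/idP/imsetP => [vt|[[b w] + ->]]; last by rewrite !inE.
by exists (thead v, behead_tuple v); rewrite ?inE //= /g [LHS]tuple_eta; apply: val_inj.
Qed.

(** [None] is the star, which conflicts with nothing. *)
Definition conflict (p q : option bool) : bool :=
  if (p, q) is (Some b, Some c) then b (+) c else false.

(** * Geometric sums of negative powers of two *)

Section PowersOfTwo.
Local Open Scope ring_scope.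

Lemma expr2N_half (R : realFieldType) n : 2 ^- n.+1 + 2 ^- n.+1 = 2 ^- n :> R.
Proof. by rewrite -mulr2n -[LHS]mulr_natl exprS invfM mulrA divff ?mul1r ?pnatr_eq0. Qed.

(** An equality when [t <= D], by telescoping; beyond that the sum is empty and [2 ^- D] alone
    dominates. It is the summation by parts for one word with [t] stars. *)
Lemma expr2N_le (R : realFieldType) t D :
  2 ^- t <= \sum_(j < D | (t <= j)%N) 2 ^- j.+1 + 2 ^- D :> R.
Proof.
elim: D => [|D IH].
  by rewrite big_ord0 add0r expr0 invr1 invf_le1 ?exprn_ege1 ?exprn_gt0 // ler1n.
have [tD|Dt] := leqP t D.
  rewrite big_mkcond big_ord_recr /= -big_mkcond /= tD (le_trans IH) //.
  by rewrite -addrA expr2N_half.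
apply: (@le_trans _ _ (2 ^- D.+1)).
  by rewrite lef_pV2 ?posrE ?exprn_gt0 // ler_weXn2l // ler1n.
by rewrite lerDr sumr_ge0 // => j _; rewrite invr_ge0 exprn_ge0.
Qed.

Lemma sum_expr2N (R : realFieldType) J D : (J <= D)%N ->
  \sum_(i < J) 2 ^- (D - i) + 2 ^- D = 2 ^- (D - J) :> R.
Proof.
elim: J => [|J IH] JD; first by rewrite big_ord0 add0r subn0.
rewrite big_ord_recr /= addrAC IH ?(ltnW JD) // -subnSK //.
exact: expr2N_half.
Qed.

End PowersOfTwo.

(** * Words with stars, their subcubes and the level sets *)

Section Codes.
Variable d : nat.
Implicit Types u v : 'I_d -> option bool.

Definition conflicts u v : nat := \sum_i conflict (u i) (v i).

Definition stars u : nat := \sum_i (u i == None).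

Definition subcube u : {set {ffun 'I_d -> bool}} :=
  [set x in family (fun i b => if u i is Some c then b == c else true)].

Lemma mem_subcube u x i c : x \in subcube u -> u i = Some c -> x i = c.
Proof. by rewrite inE => /familyP/(_ i); rewrite unfold_in => + E; rewrite E => /eqP. Qed.

Lemma card_subcube u : #|subcube u| = 2 ^ stars u.
Proof.
rewrite cardsE card_family foldrE big_image /= /stars expn_sum; apply: eq_bigr => i _.
case: (u i) => [c|] /=; last by rewrite card_bool.
exact: card1.
Qed.

(** Where two points differ, either the words conflict or one of them has a star. *)
Lemma hamming_subcube u v x y : x \in subcube u -> y \in subcube v ->
  hamming x y <= conflicts u v + (stars u + stars v).
Proof.
move=> xu yv; rewrite /conflicts /stars -!big_split; apply: leq_sum => i _.
case ui: (u i) => [b|]; case vi: (v i) => [c|]; rewrite /=.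
- by rewrite (mem_subcube xu ui) (mem_subcube yv vi) !addn0.
all: by apply: leq_trans (leq_b1 _) _.
Qed.

Lemma conflictsP u v : 0 < conflicts u v ->
  exists i c, u i = Some c /\ v i = Some (~~ c).
Proof.
rewrite lt0n sum_nat_eq0 negb_forall => /existsP[i].
rewrite /= eqb0 negbK => uv; exists i; move: uv.
case: (u i) => [b|]; case: (v i) => [c|] //= bc; exists b; split=> //.
by case: b c bc => -[].
Qed.

Lemma conflictsxx u : conflicts u u = 0.
Proof. by rewrite /conflicts big1 // => i _; case: (u i) => //= -[]. Qed.

Lemma stars_le u : stars u <= d.
Proof.
rewrite -[X in _ <= X]card_ord -sum1_card; apply: leq_sum => i _; exact: leq_b1.
Qed.

Variables (I : finType) (k : nat) (u : I -> 'I_d -> option bool).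
Hypothesis neighborly_u : forall s t, s != t -> 0 < conflicts (u s) (u t) <= k.

Lemma conflicts_le s t : conflicts (u s) (u t) <= k.
Proof.
by have [->|/neighborly_u/andP[]//] := eqVneq s t; rewrite conflictsxx.
Qed.

(* The coordinates where [u t] conflicts with a star-free [u s] determine [t]. *)
Lemma card_codes_star_free s : stars (u s) = 0 -> #|I| <= ball_size d k.
Proof.
move=> /eqP; rewrite sum_nat_eq0 => /forallP us.
have {}us i : {c | u s i = Some c}.
  by have := us i; case: (u s i) => // c _; exists c.
pose A t := [set i | conflict (u s i) (u t i)].
have AI : injective A.
  move=> t t' /setP AA; apply: contraTeq isT => /neighborly_u/andP[/conflictsP[i [c [ti t'i]]] _].
  have [b si] := us i.
  by have := AA i; rewrite !inE si ti t'i; case: (b) (c) => -[].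
rewrite -card_small_sets -(card_imset predT AI) subset_leq_card //.
apply/fintype.subsetP => _ /imsetP[t _ ->]; rewrite inE.
by rewrite -sum1dep_card big_mkcond (leq_trans _ (conflicts_le s t)).
Qed.

Definition level j := \bigcup_(s | stars (u s) <= j) subcube (u s).

(** Two distinct words conflict somewhere, so their subcubes are disjoint and the sizes add up. *)
Lemma card_level j : #|level j| = \sum_(s | stars (u s) <= j) 2 ^ stars (u s).
Proof.
rewrite -sum1_card /level [\bigcup_(_ | _) _]big_mkcond partition_disjoint_bigcup /=; last first.
  move=> s t st; case: ifP => _; case: ifP => _; rewrite -setI_eq0 ?finset.setI0 ?finset.set0I //.
  have /andP[/conflictsP[i [c [si ti]]] _] := neighborly_u st.
  apply/eqP/setP => x; rewrite finset.in_setI finset.in_set0; apply/andP => -[xs xt].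
  by have := mem_subcube xs si; rewrite (mem_subcube xt ti); case: (c).
rewrite [X in _ = X]big_mkcond; apply: eq_bigr => s _; rewrite sum1_card.
by case: ifP; rewrite ?cards0 // card_subcube.
Qed.

Lemma hamming_level i j x y : x \in level i -> y \in level j ->
  hamming x y <= k + (i + j).
Proof.
move=> /bigcupP[s si xs] /bigcupP[t tj yt].
by rewrite (leq_trans (hamming_subcube xs yt)) // !leq_add // conflicts_le.
Qed.

Lemma card_level_Bconf j : k + 2 * j < d -> #|level j| <= #|Bconf (k + 2 * j) d|.
Proof.
move=> kjd; rewrite card_Bconf; last by lia.
by apply: kleitman => // x y xj yj; rewrite mul2n -addnn hamming_level.
Qed.

Lemma card_levelD i j : k + (i + j) < d -> #|level i| + #|level j| <= 2 ^ d.
Proof.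
by move=> kd; apply: card_antipodes => x y xi yj; apply: leq_ltn_trans kd; apply: hamming_level.
Qed.

Lemma card_level0 : (forall s, stars (u s) != 0) -> #|level 0| = 0.
Proof.
by move=> us; rewrite card_level big_pred0 // => s; rewrite leqn0 (negbTE (us s)).
Qed.

Local Open Scope ring_scope.

(** Each word counts as [2 ^+ stars] times [2 ^- stars]. Expanding the second factor by [expr2N_le]
    and exchanging the sums collects the levels; the remainder is bounded by the total volume of the
    disjoint subcubes. *)
Lemma card_codes_le (R : realFieldType) D :
  #|I|%:R <= \sum_(j < D) 2 ^- j.+1 * #|level j|%:R + 2 ^- D * 2 ^+ d :> R.
Proof.
have tot : \sum_s 2 ^+ stars (u s) <= 2 ^+ d :> R.
  have -> : \sum_s 2 ^+ stars (u s) = #|level d|%:R :> R.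
    rewrite card_level natr_sum; apply: eq_big => [s|s _]; first by rewrite stars_le.
    by rewrite natrX.
  by rewrite -natrX ler_nat (leq_trans (max_card _)) // card_ffun card_bool card_ord.
have hD : 0 <= 2 ^- D :> R by rewrite invr_ge0 exprn_ge0.
apply: (@le_trans _ _ (\sum_s 2 ^+ stars (u s) *
    (\sum_(j < D | (stars (u s) <= j)%N) 2 ^- j.+1 + 2 ^- D))).
  rewrite -sum1_card natr_sum; apply: ler_sum => s _.
  have s0 : 0 < 2 ^+ stars (u s) :> R by rewrite exprn_gt0.
  by rewrite -ler_pdivrMl // mulr1 expr2N_le.
under eq_bigr do rewrite mulrDr.
rewrite big_split /= -mulr_suml mulrC lerD //; last by rewrite ler_wpM2l.
under eq_bigr do rewrite mulr_sumr.
rewrite (exchange_big_dep predT) //=; apply: ler_sum => j _.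
rewrite card_level natr_sum mulr_sumr; apply: ler_sum => s _.
by rewrite natrX mulrC.
Qed.

End Codes.

(** * Pairing the levels in the weighted sum *)

Local Open Scope ring_scope.

(** The last [J] terms are reflected onto the first [J], and the middle ones are kept. The reflected
    copies of [N] add up with [2 ^- D] to [2 ^- (D - J)]. *)
Lemma weighted_sum_le (R : realFieldType) (S B : nat -> R) (N : R) J D :
  (J.*2 <= D)%N -> S 0%N = 0 ->
  (forall j, (j < D)%N -> S j + S (D.-1 - j)%N <= N) ->
  (forall j, (0 < j < J)%N -> S j <= B j) ->
  \sum_(j < D) 2 ^- j.+1 * S j + 2 ^- D * N <=
  \sum_(1 <= j < J) (2 ^- j.+1 - 2 ^- (D - j)) * B j
  + \sum_(J <= j < D - J) 2 ^- j.+1 * S j + 2 ^- (D - J) * N.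
Proof.
move=> JD S0 SN SB.
have hi : \sum_(D - J <= j < D) 2 ^- j.+1 * S j <=
    \sum_(0 <= i < J) 2 ^- (D - i) * (N - S i).
  rewrite -{1}[(D - J)%N]add0n big_addn subKn; last by lia.
  rewrite big_nat_rev /= !big_mkord; apply: ler_sum => i _.
  have iJ := ltn_ord i.
  have -> : (0 + J - i.+1 + (D - J) = D.-1 - i)%N by lia.
  have -> : ((D.-1 - i).+1 = D - i)%N by lia.
  rewrite ler_wpM2l ?invr_ge0 ?exprn_ge0 // lerBrDl SN //; lia.
(* The combined coefficient is nonnegative because [J.*2 <= D], so [S i] may be replaced by [B i];
   index 0 drops out by [S 0 = 0]. *)
have lo : \sum_(0 <= i < J) (2 ^- i.+1 - 2 ^- (D - i)) * S i <=
    \sum_(1 <= j < J) (2 ^- j.+1 - 2 ^- (D - j)) * B j.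
  have [->|J0] := posnP J; first by rewrite !big_geq.
  rewrite big_ltn // S0 mulr0 add0r [leLHS]big_nat_cond [leRHS]big_nat_cond.
  apply: ler_sum => i; rewrite andbT => iJ; apply: ler_wpM2l; last exact: SB.
  rewrite subr_ge0 lef_pV2 ?posrE ?exprn_gt0 // ler_weXn2l ?ler1n //; lia.
rewrite -(big_mkord xpredT (fun j => 2 ^- j.+1 * S j)).
rewrite (big_cat_nat (n := J)) //=; last by lia.
rewrite [\sum_(J <= _ < D) _](big_cat_nat (n := (D - J)%N)) /=; [|lia|lia].
have cst := sum_expr2N R (J := J) (D := D) ltac:(lia).
have eN : \sum_(0 <= i < J) 2 ^- (D - i) * (N - S i) =
    \sum_(i < J) 2 ^- (D - i) * N - \sum_(0 <= i < J) 2 ^- (D - i) * S i.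
  by rewrite big_mkord big_mkord -sumrB; apply: eq_bigr => i _; rewrite mulrBr.
have eS : \sum_(0 <= i < J) (2 ^- i.+1 - 2 ^- (D - i)) * S i =
    \sum_(0 <= i < J) 2 ^- i.+1 * S i - \sum_(0 <= i < J) 2 ^- (D - i) * S i.
  by rewrite -sumrB; apply: eq_bigr => i _; rewrite mulrBl.
rewrite -mulr_suml in eN; rewrite -cst mulrDl; rewrite eN in hi; rewrite eS in lo.
lra.
Qed.

(** * From boxes to words *)

(** The direction of the box is spanned by the basis vectors of its nondegenerate coordinates. *)
Lemma box_dim (R : realType) d (a b : 'rV[R]_d) m :
  (forall i, a 0 i <= b 0 i) -> has_dim (box a b) m ->
  m = #|[set i | a 0 i < b 0 i]|.
Proof.
move=> ab [_ [V [hV Vmin <-]]]; set A := [set i | a 0 i < b 0 i].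
pose X (B : {set 'I_d}) : seq 'rV[R]_d := [seq delta_mx 0 i | i <- enum B].
have dimX B : (\dim <<X B>> <= #|B|)%N.
  by rewrite (leq_trans (dim_span _)) // size_map -cardE.
have memX (B : {set 'I_d}) i : i \in B -> delta_mx 0 i \in <<X B>>%VS.
  by move=> Bi; apply/memv_span/map_f; rewrite mem_enum.
have VX : V = <<X A>>%VS.
  apply/eqP; rewrite eqEsubv; apply/andP; split.
    apply: Vmin => x y bx bby; rewrite [x - y]row_sum_delta.
    apply: memv_suml => i _; have [iA|] := boolP (i \in A); first by rewrite memvZ ?memX.
    rewrite inE -leNgt => ba; rewrite (_ : (x - y) 0 i = 0) ?scale0r ?mem0v //.
    have /andP[ax xb] := bx i; have /andP[ay yb] := bby i.
    by rewrite !mxE; lra.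
  apply/span_subvP => _ /mapP[i + ->]; rewrite mem_enum inE => abi.
  have di0 : b 0 i - a 0 i != 0 by rewrite subr_eq0 gt_eqF.
  rewrite -[delta_mx 0 i]scale1r -(mulVf di0) -scalerA memvZ //.
  rewrite -[_ *: _](addrK a); apply: hV => j; last by rewrite lexx ab.
  rewrite !mxE eqxx /=; case: eqVneq => [->|_].
    by rewrite mulr1 subrK lexx ab.
  by rewrite mulr0 add0r lexx ab.
apply/eqP; rewrite VX eqn_leq dimX /=.
(* The spans over [A] and over its complement have dimension at most the number of their generators
   and together fill the space, so both bounds are equalities. *)
suff : (d <= \dim <<X A>> + \dim <<X (~: A)>>)%N.
  have := cardsC A; rewrite card_ord => cA dA.
  by rewrite -(leq_add2r #|~: A|) cA (leq_trans dA) // leq_add2l.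
rewrite (leq_trans _ (dimv_add_leqif _ _)) //.
suff -> : (<<X A>> + <<X (~: A)>> = fullv)%VS by rewrite dimvf dim_matrix mul1r.
apply/vspaceP => x; rewrite memvf [x]row_sum_delta; apply: memv_suml => i _.
rewrite memvZ //; have [iA|iA] := boolP (i \in A).
  by apply: (subvP (addvSl _ _)); rewrite memX.
by apply: (subvP (addvSr _ _)); rewrite memX // inE.
Qed.

(* [Some false] marks a coordinate where some member lies above the box, and
   [Some true] one where some member lies below it; by pairwise intersection
   the two are exclusive, and opposite marks mean exactly that the two boxes
   touch in that coordinate. *)
Lemma neighborly_family_codes (R : realType) d k (F : set (set 'rV[R]_d)) n :
  (k <= d)%N -> neighborly_family k F -> (F #= `I_n)%card ->
  exists u : 'I_n -> 'I_d -> option bool,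
    forall s t, s != t -> (0 < conflicts (u s) (u t) <= k)%N.
Proof.
move=> kd [_ hF hI]; rewrite card_eq_sym => /pcard_eqP[f].
have Ff (s : 'I_n) : F (f s) by apply: funS => /=.
have fI (s t : 'I_n) : s != t -> f s <> f t.
  by apply: contra_neq_not => E; apply/val_inj; apply: (inj (f := f)) E; rewrite inE /=.
have /choice[ab abE] : forall s : 'I_n, exists ab : 'rV[R]_d * 'rV[R]_d,
    f s = box ab.1 ab.2.
  by move=> s; have [[a [b [_ ->]]] _] := hF _ (Ff s); exists (a, b).
pose a s := (ab s).1; pose b s := (ab s).2.
have {}abE (s : 'I_n) : f s = box (a s) (b s) by apply: abE.
have ab_lt s i : a s 0 i < b s 0 i.
  by apply: box_full_lt; rewrite -abE; have [] := hF _ (Ff s).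
have dimI s t : s != t -> exists m, (d - k <= m < d)%N /\
    has_dim (box (\row_i Num.max (a s 0 i) (a t 0 i)) (\row_i Num.min (b s 0 i) (b t 0 i))) m.
  move=> st; rewrite -boxI -!abE; apply: hI => //; exact: fI.
(* Since any two members meet, every lower end is at most every upper end. *)
have ab_le s t i : a s 0 i <= b t 0 i.
  have [->|st] := eqVneq s t; first exact: ltW.
  have [m [_ [[x /(_ i)]]]] := dimI _ _ st.
  by rewrite !mxE ge_max le_min => /andP[/andP[ax _] /andP[_ xb]] _; exact: le_trans ax xb.
pose above s i := [exists t, b s 0 i <= a t 0 i].
pose below s i := [exists t, b t 0 i <= a s 0 i].
(* Any upper end with a start above it lies below any lower end with an end below it, by [ab_le];
   touching thus splits into one condition on each box. *)
have touchE s t i : (b s 0 i <= a t 0 i) = above s i && below t i.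
  apply/idP/andP => [st|[/existsP[m sm] /existsP[l lt]]].
    by split; apply/existsP; [exists t | exists s].
  exact: le_trans sm (le_trans (ab_le _ _ _) lt).
pose u s i := if above s i then Some false else if below s i then Some true else None.
exists u => s t st.
have conflictE i : conflict (u s i) (u t i) = (b s 0 i <= a t 0 i) || (b t 0 i <= a s 0 i).
  rewrite !touchE /u; have := touchE s s i; have := touchE t t i.
  rewrite !leNgt !ab_lt /=.
  by case: (above s i); case: (below s i); case: (above t i); case: (below t i).
have [m [dm]] := dimI _ _ st.
move=> /box_dim E; move: dm; rewrite {m}E; last first.
  by move=> i; rewrite !mxE ge_max !le_min !ab_le ?ltW.
(* Conflicts are exactly the degenerate coordinates of the intersection, so their number is [d]
   minus its dimension. *)
set A := [set i | _]; suff -> : conflicts (u s) (u t) = #|~: A|.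
  have := cardsC A; rewrite card_ord; lia.
rewrite -sum1_card [RHS]big_mkcond; apply: eq_bigr => i _.
rewrite conflictE !inE !mxE gt_max !lt_min !ab_lt andbT /= negb_and -!leNgt.
by rewrite orbC; case: (_ || _).
Qed.

Theorem theorem1p5 (R : realType) (k d : nat)
    (hk : (1 <= k)%N) (hkd : (k <= d - 1)%N) :
  (~~ odd (d - k) ->
     (neighborly_number R k d)%:R <=
       Num.max
         (\sum_(0 <= j < k.+1) 'C(d, j)%:R)
         (\sum_(1 <= j < ((d - k - 2) %/ 2).+1)
             (1 / 2 ^+ (j + 1) - 1 / 2 ^+ (d - k - j)) *
               #|Bconf (k + 2 * j) d|%:R
          + 2 ^+ ((d + k) %/ 2)) :> R) /\
  (odd (d - k) ->
     (neighborly_number R k d)%:R <=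
       Num.max
         (\sum_(0 <= j < k.+1) 'C(d, j)%:R)
         (\sum_(1 <= j < ((d - k - 3) %/ 2).+1)
             (1 / 2 ^+ (j + 1) - 1 / 2 ^+ (d - k - j)) *
               #|Bconf (k + 2 * j) d|%:R
          + 1 / 2 ^+ ((d - k + 1) %/ 2) * #|Bconf (d - 1) d|%:R
          + 2 ^+ ((d + k - 1) %/ 2)) :> R).
Proof.
rewrite /neighborly_number; case: ex_maxnP => n /asboolP[F [nF Fn]] _.
have [|u hu] := neighborly_family_codes _ nF Fn; first by lia.
(* A star-free word gives the first term of the maximum in both parities; otherwise level 0 is
   empty. *)
case: (pickP (fun s => stars (u s) == 0%N)) => [s /eqP us|us].
  have := card_codes_star_free hu us; rewrite card_ord -(ler_nat R).
  rewrite /ball_size natr_sum -(big_mkord xpredT (fun j => 'C(d, j)%:R : R)) => nk.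
  by split=> _; rewrite le_max nk.
pose S j := #|level u j|%:R : R; pose B j := #|Bconf (k + 2 * j) d|%:R : R.
pose D := (d - k)%N.
have := card_codes_le hu R D; rewrite card_ord => nD.
have bound J : (J.*2 <= D)%N -> n%:R <=
    \sum_(1 <= j < J) (1 / 2 ^+ (j + 1) - 1 / 2 ^+ (d - k - j)) * B j
    + \sum_(J <= j < D - J) 2 ^- j.+1 * S j + 2 ^+ (k + J).
  move=> JD; apply: le_trans nD _.
  have := @weighted_sum_le R S B (2 ^+ d) J D JD.
  have -> : 2 ^+ (k + J) = 2 ^- (D - J) * 2 ^+ d :> R.
    have dE : d = (D - J + (k + J))%N by lia.
    by rewrite [X in _ * _ ^+ X]dE [in RHS]exprD mulKf // expf_neq0 ?pnatr_eq0.
  have -> : \sum_(1 <= j < J) (1 / 2 ^+ (j + 1) - 1 / 2 ^+ (d - k - j)) * B j =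
            \sum_(1 <= j < J) (2 ^- j.+1 - 2 ^- (D - j)) * B j.
    by apply: eq_bigr => j _; rewrite !div1r addn1.
  apply.
  - by rewrite /S (card_level0 hu) // => s; rewrite us.
  - move=> j jD; rewrite /S -natrD -natrX ler_nat (card_levelD hu) //; lia.
  - move=> j jJ; rewrite /S /B ler_nat (card_level_Bconf hu) //; lia.
split=> par; rewrite le_max; apply/orP; right.
  (* For even [D] the cut in the middle leaves no unpaired level. *)
  have := bound D./2; rewrite (_ : (D - D./2 = D./2)%N); last by lia.
  rewrite (big_geq (leqnn _)) addr0.
  have -> : ((d - k - 2) %/ 2).+1 = D./2 by lia.
  have -> : ((d + k) %/ 2 = k + D./2)%N by lia.
  apply; lia.
have {}bound := bound D./2.
(* For odd [D] the level [D./2] is its own partner. It stays in the sum and is bounded by Kleitman's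
   theorem at diameter [k + 2 * D./2], which is [d - 1]. *)
move: bound; rewrite (_ : (D - D./2 = D./2.+1)%N); last by lia.
rewrite big_nat1.
have -> : \sum_(1 <= j < ((d - k - 3) %/ 2).+1)
      (1 / 2 ^+ (j + 1) - 1 / 2 ^+ (d - k - j)) * #|Bconf (k + 2 * j) d|%:R =
    \sum_(1 <= j < D./2) (1 / 2 ^+ (j + 1) - 1 / 2 ^+ (d - k - j)) * B j.
  (* For [D = 1] truncated subtraction makes the upper limits 1 and 0 differ, but both sums are
     empty. *)
  have [D1|D1] := leqP D 1; first by rewrite !big_geq //; lia.
  by rewrite (_ : ((d - k - 3) %/ 2).+1 = D./2) //; lia.
have -> : ((d + k - 1) %/ 2 = k + D./2)%N by lia.
have -> : ((d - k + 1) %/ 2 = D./2.+1)%N by lia.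
move=> bound; apply: le_trans (bound _) _; first by lia.
rewrite lerD2r lerD2l div1r ler_wpM2l ?invr_ge0 ?exprn_ge0 // /S ler_nat.
have -> : (d - 1 = k + 2 * D./2)%N by lia.
by rewrite (card_level_Bconf hu) //; lia.
Qed.
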